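(* No class $K\subseteq 2^{\mathbb{N}}$ (with or without any definability assumption) satisfies any one of the following three properties. (Property 4.6) For every $e\in\mathbb{N}$ and every real $A$ with $\mathcal{O}\leq_{\mathrm T}A$, there exists $B\in K$ such that $A\equiv_{\mathrm T}\mathrm{HJ}_e(B)\equiv_{\mathrm T}B\oplus\mathcal{O}$. (Property 4.7) For every $e\in\mathbb{N}$ and all reals $Z$ and $A$ such that $Z\oplus\mathcal{O}\leq_{\mathrm T}A$ and $\emptyset<_{\mathrm{HYP}}(Z)_k$ for every $k\in\mathbb{N}$, there exists $B\in K$ such that $A\equiv_{\mathrm T}\mathrm{HJ}_e(B)\equiv_{\mathrm T}B\oplus\mathcal{O}$ and $(Z)_k\not\leq_{\mathrm{HYP}}B$ for every $k\in\mathbb{N}$. (Property 4.8) For every $e\in\mathbb{N}$ and all reals $Z$ and $A$ such that $Z\oplus\mathcal{O}\leq_{\mathrm T}A$ and $\emptyset<_{\mathrm{HYP}}Z$, there exists $B\in K$ such that $A\equiv_{\mathrm T}\mathrm{HJ}_e(B)\equiv_{\mathrm T}B\oplus Z\equiv_{\mathrm T}B\oplus\mathcal{O}$. That is, for every $K\subseteq 2^{\mathbb{N}}$, each of the three properties fails for $K$.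
   Context: Reals are subsets of $\mathbb{N}$, identified with elements of $2^{\mathbb{N}}$. $\leq_{\mathrm T}$ and $\leq_{\mathrm{HYP}}$ are Turing and hyperarithmetical reducibility; $\equiv_{\mathrm T}$ is Turing equivalence, and $X<_{\mathrm{HYP}}Y$ means $X\leq_{\mathrm{HYP}}Y$ and $Y\not\leq_{\mathrm{HYP}}X$. $X\oplus Y$ is the usual effective join. For a real $Z$ and $k\in\mathbb{N}$, the $k$-th column is $(Z)_k=\{n:2^k3^n\in Z\}$. For a real $X$, $\mathcal{O}^X$ is the relativized Kleene $\mathcal{O}$ (the hyperjump of $X$), which is $\Pi^{1,X}_1$-complete uniformly in $X$ (its Turing degree is that of the set of indices of $X$-recursive well-orderings), and $\mathcal{O}=\mathcal{O}^{\emptyset}$. All analytical pointclasses are lightface, with oracle parameters indicated. Let $(V_e^X)_{e\in\mathbb{N}}$ be a standard effective enumeration, uniform in $X$, of the $\Pi^{1,X}_1$ subsets of $\mathbb{N}$; in particular, for every $\Pi^1_1$ predicate $Q(n,X)$ there is an $e$ such that $V_e^X=\{n:Q(n,X)\}$ for every real $X$. The pseudo-hyperjump operators are $\mathrm{HJ}_e(X)=X\oplus V_e^X$. *)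

(* Defs.v *)
From Stdlib Require Import Arith Cantor.

Definition real := nat -> Prop.

Definition empty : real := fun _ => False.

Definition join (X Y : real) : real :=
  fun m => exists n, (m = 2 * n /\ X n) \/ (m = 2 * n + 1 /\ Y n).

Definition column (Z : real) (k : nat) : real := fun n => Z (2 ^ k * 3 ^ n).

(** * Oracle computability *)

Definition pr (x y : nat) : nat := Cantor.to_nat (x, y).

(** Programs for unary partial functions; several arguments are passed through
    the Cantor pairing. *)
Inductive code : Type :=
| Zero | Succ | Fst | Snd | Oracle
| Pair (f g : code)
| Comp (f g : code)
| Prec (f g : code)
| Mu (f : code).

(** [eval X c n m]: with oracle [X], the program [c] halts on [n] with
    value [m]. *)
Inductive eval (X : real) : code -> nat -> nat -> Prop :=
| ev_zero n : eval X Zero n 0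
| ev_succ n : eval X Succ n (S n)
| ev_fst x y : eval X Fst (pr x y) x
| ev_snd x y : eval X Snd (pr x y) y
| ev_in n : X n -> eval X Oracle n 1
| ev_out n : ~ X n -> eval X Oracle n 0
| ev_pair f g n a b :
    eval X f n a -> eval X g n b -> eval X (Pair f g) n (pr a b)
| ev_comp f g n a b :
    eval X g n a -> eval X f a b -> eval X (Comp f g) n b
| ev_prec0 f g x a : eval X f x a -> eval X (Prec f g) (pr x 0) a
| ev_precS f g x i a b :
    eval X (Prec f g) (pr x i) a -> eval X g (pr x (pr i a)) b ->
    eval X (Prec f g) (pr x (S i)) b
| ev_mu f x k :
    (forall i, i < k -> exists v, eval X f (pr x i) (S v)) ->
    eval X f (pr x k) 0 -> eval X (Mu f) x k.

Fixpoint encode (c : code) : nat :=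
  match c with
  | Zero => pr 0 0
  | Succ => pr 1 0
  | Fst => pr 2 0
  | Snd => pr 3 0
  | Oracle => pr 4 0
  | Pair f g => pr 5 (pr (encode f) (encode g))
  | Comp f g => pr 6 (pr (encode f) (encode g))
  | Prec f g => pr 7 (pr (encode f) (encode g))
  | Mu f => pr 8 (encode f)
  end.

Lemma pr_inj x y x' y' : pr x y = pr x' y' -> x = x' /\ y = y'.
Proof.
  intros H; apply (f_equal Cantor.of_nat) in H; unfold pr in H.
  rewrite !Cantor.cancel_of_to in H; now inversion H.
Qed.

Lemma encode_inj c d : encode c = encode d -> c = d.
Proof.
  revert d; induction c; intros d; destruct d; simpl; intros H;
    apply pr_inj in H; destruct H as [H1 H2]; try discriminate; try reflexivity;
    try (apply pr_inj in H2; destruct H2); f_equal; auto.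
Qed.

(** [phi X e n m] is {e}^X(n) = m; numbers that are not the code of a program
    are indices of the nowhere defined function. *)
Definition phi (X : real) (e n m : nat) : Prop :=
  exists c, encode c = e /\ eval X c n m.

Lemma eval_Prec_inv X f g p b :
  eval X (Prec f g) p b ->
  (exists x, p = pr x 0 /\ eval X f x b) \/
  (exists x i a, p = pr x (S i) /\ eval X (Prec f g) (pr x i) a /\
                 eval X g (pr x (pr i a)) b).
Proof. intros H; inversion H; subst; eauto 10. Qed.

Lemma eval_functional X c n m m' : eval X c n m -> eval X c n m' -> m = m'.
Proof.
  revert n m m'; induction c as [| | | | | f IHf g IHg | f IHf g IHg
                                | f IHf g IHg | f IHf].
  8: {
    assert (R : forall i x m m', eval X (Prec f g) (pr x i) m ->
                                 eval X (Prec f g) (pr x i) m' -> m = m').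
    { induction i as [| i IH]; intros x m m' H H';
        apply eval_Prec_inv in H, H';
        destruct H as [[y [E H]] | [y [j [a [E [Ha H]]]]]],
                 H' as [[y' [E' H']] | [y' [j' [a' [E' [Ha' H']]]]]];
        apply pr_inj in E, E'; destruct E as [-> E], E' as [-> E'];
        try discriminate.
      - eauto.
      - injection E as <-; injection E' as <-.
        assert (a = a') by eauto; subst; eauto. }
    intros n m m' H H'.
    destruct (eval_Prec_inv _ _ _ _ _ H)
      as [[x [-> _]] | [x [i [a [-> _]]]]]; eauto. }
  all: intros n m m' H H'; inversion H; subst; inversion H'; subst;
    try reflexivity; try contradiction.
  1, 2: match goal with E : pr _ _ = pr _ _ |- _ => apply pr_inj in E as [? ?]; congruence end.
  - f_equal; eauto.
  - assert (a = a0) by eauto; subst; eauto.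
  - match goal with
    | F : forall i, i < ?k -> _, F' : forall i, i < ?l -> _ |- ?k = ?l =>
        destruct (lt_eq_lt_dec k l) as [[L | L] | L];
        [destruct (F' k L) as [v Hv] | exact L | destruct (F l L) as [v Hv]]
    end; assert (0 = S v) by eauto; discriminate.
Qed.

Definition le_T (X Y : real) : Prop :=
  exists c, forall n,
    (X n -> eval Y c n 1) /\ (~ X n -> eval Y c n 0).

Definition eq_T (X Y : real) : Prop := le_T X Y /\ le_T Y X.

Definition jump (X : real) : real := fun e => exists m, phi X e e m.

(** * Kleene's O and hyperarithmetical reducibility *)

Inductive KleeneO (X : real) : nat -> Prop :=
| O_one : KleeneO X 1
| O_suc a : KleeneO X a -> KleeneO X (2 ^ a)
| O_lim e s :
    (forall n, phi X e n (s n)) ->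
    (forall n, KleeneO X (s n)) ->
    (forall n, ltO X (s n) (s (S n))) ->
    KleeneO X (3 * 5 ^ e)
with ltO (X : real) : nat -> nat -> Prop :=
| ltO_suc a : KleeneO X a -> ltO X a (2 ^ a)
| ltO_lim e s n :
    (forall i, phi X e i (s i)) ->
    (forall i, KleeneO X (s i)) ->
    (forall i, ltO X (s i) (s (S i))) ->
    ltO X (s n) (3 * 5 ^ e)
| ltO_trans a b c : ltO X a b -> ltO X b c -> ltO X a c.

(** [Hset X a Y]: [Y] is the set H_a^X of the hyperarithmetical hierarchy
    over [X]. *)
Inductive Hset (X : real) : nat -> real -> Prop :=
| H_one : Hset X 1 X
| H_suc a Y : Hset X a Y -> Hset X (2 ^ a) (jump Y)
| H_lim e s (Y : nat -> real) :
    (forall n, phi X e n (s n)) ->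
    (forall n, Hset X (s n) (Y n)) ->
    Hset X (3 * 5 ^ e) (fun m => exists n x, m = pr n x /\ Y n x).

Definition le_HYP (X Y : real) : Prop :=
  exists a H, KleeneO Y a /\ Hset Y a H /\ le_T X H.

Definition lt_HYP (X Y : real) : Prop := le_HYP X Y /\ ~ le_HYP Y X.

(** * Pseudo-hyperjumps *)

Definition graph (f : nat -> nat) : real := fun m => exists i, m = pr i (f i).

(** Kleene's normal form enumeration of the Pi^1_1(X) sets. The universal
    quantifier ranges over Baire space: over Cantor space it would only give
    the Sigma^0_1(X) sets. *)
Definition V (e : nat) (X : real) : real :=
  fun n => forall f : nat -> nat, exists m, phi (join X (graph f)) e n m.

Definition HJ (e : nat) (X : real) : real := join X (V e X).

(* Main.v *)
(** Take the set V^X of all [n] such that [n] is an index of a total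
    X-recursive function whose first component is the characteristic function
    of O and whose second component vanishes at [n].  If O is not recursive in
    B then V^B is empty and its join with B cannot compute O; if O is recursive
    in B then V^B is not, by diagonalization.  So the join of B and V^B is never
    Turing equivalent to that of B and O, whatever A is.

    V^X is Pi^1_1 in X, uniformly, because {O} is a Pi^1_1 singleton.  A set Y
    differs from O iff it is not contained in some set closed under the rules
    generating O, or violates one of these rules itself.  The limit rule for Y
    mentions the order <_O, but along O this order is determined by the
    equations that unfold it one step, so any solution L of these equations can
    be used.  The function quantifier of V supplies closed sets, Skolem
    functions and the table of a universal evaluator, which leaves only local
    conditions on this function to be checked by a program.

    Hyperarithmetical sets are named by pairs of a notation and a program, so
    diagonalization gives a Z that makes the last two properties non-vacuous. *)

From Stdlib Require Import Arith Lia Cantor Bool ClassicalEpsilon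
  FunctionalExtensionality PropExtensionality.
Require Import Defs.

(** * Extensionality, projections of the pairing, characteristic functions *)

Lemma real_ext (X Y : real) : (forall n, X n <-> Y n) -> X = Y.
Proof.
  intros H; apply functional_extensionality; intros n.
  apply propositional_extensionality; auto.
Qed.

Definition p1 (p : nat) : nat := fst (Cantor.of_nat p).
Definition p2 (p : nat) : nat := snd (Cantor.of_nat p).

Lemma p1_pr x y : p1 (pr x y) = x.
Proof. unfold p1, pr; now rewrite Cantor.cancel_of_to. Qed.

Lemma p2_pr x y : p2 (pr x y) = y.
Proof. unfold p2, pr; now rewrite Cantor.cancel_of_to. Qed.

Lemma pr_p p : pr (p1 p) (p2 p) = p.
Proof.
  unfold p1, p2, pr; rewrite <- surjective_pairing; apply Cantor.cancel_to_of.
Qed.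

Definition chi (X : real) (n : nat) : nat :=
  if excluded_middle_informative (X n) then 1 else 0.

Lemma chi_in X n : X n -> chi X n = 1.
Proof. unfold chi; destruct excluded_middle_informative; tauto. Qed.

Lemma chi_out X n : ~ X n -> chi X n = 0.
Proof. unfold chi; destruct excluded_middle_informative; tauto. Qed.

Lemma chi_true X n : chi X n = 1 -> X n.
Proof. unfold chi; destruct excluded_middle_informative; easy. Qed.

Lemma eval_Oracle X n : eval X Oracle n (chi X n).
Proof.
  unfold chi; destruct excluded_middle_informative; now constructor.
Qed.

(** * Uniformly computable families *)

Section Computable.
Context {I : Type} (orc : I -> real).

(** One program serves every oracle of the family: with [I] a singleton this is computability in a
    fixed real, while over all pairs of a real and a function it will yield an index independent of
    both. *)
Definition cp (F : I -> nat -> nat) : Prop :=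
  exists c, forall i n, eval (orc i) c n (F i n).

Definition cpb (P : I -> nat -> bool) : Prop :=
  cp (fun i n => Nat.b2n (P i n)).

Lemma cp_ext F G : (forall i n, F i n = G i n) -> cp F -> cp G.
Proof. intros E [c H]; exists c; intros i n; rewrite <- E; auto. Qed.

Lemma cp_id : cp (fun i n => n).
Proof.
  (* The language has no identity program; re-pairing both projections gives one, as the pairing is
     onto. *)
  exists (Pair Fst Snd); intros i n; rewrite <- (pr_p n).
  repeat constructor.
Qed.

Lemma cp_comp F G : cp F -> cp G -> cp (fun i n => F i (G i n)).
Proof.
  intros [c Hc] [d Hd]; exists (Comp c d); intros i n.
  now apply ev_comp with (G i n).
Qed.

Lemma cp_S F : cp F -> cp (fun i n => S (F i n)).
Proof.
  intros H; apply (cp_comp (fun _ => S)); trivial.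
  exists Succ; intros; constructor.
Qed.

Lemma cp_const k : cp (fun _ _ => k).
Proof.
  induction k as [| k IH].
  - exists Zero; intros; constructor.
  - now apply cp_S.
Qed.

Lemma cp_p1 F : cp F -> cp (fun i n => p1 (F i n)).
Proof.
  intros H; apply (cp_comp (fun _ => p1)); trivial.
  exists Fst; intros i n; rewrite <- (pr_p n) at 1; constructor.
Qed.

Lemma cp_p2 F : cp F -> cp (fun i n => p2 (F i n)).
Proof.
  intros H; apply (cp_comp (fun _ => p2)); trivial.
  exists Snd; intros i n; rewrite <- (pr_p n) at 1; constructor.
Qed.

Lemma cp_pr F G : cp F -> cp G -> cp (fun i n => pr (F i n) (G i n)).
Proof.
  intros [c Hc] [d Hd]; exists (Pair c d); intros; now constructor.
Qed.

Lemma cp_oracle F : cp F -> cp (fun i n => chi (orc i) (F i n)).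
Proof.
  intros H; apply (cp_comp (fun i => chi (orc i))); trivial.
  exists Oracle; intros; apply eval_Oracle.
Qed.

Fixpoint prim (h : nat -> nat) (n a k : nat) : nat :=
  match k with
  | 0 => a
  | S k => h (pr n (pr k (prim h n a k)))
  end.

Lemma cp_prim H A G :
  cp H -> cp A -> cp G -> cp (fun i n => prim (H i) n (A i n) (G i n)).
Proof.
  intros [h Hh] [a Ha] [g Hg]; destruct cp_id as [d Hd].
  exists (Comp (Prec a h) (Pair d g)); intros i n.
  apply ev_comp with (pr n (G i n)); [now constructor |].
  induction (G i n) as [| k IH]; simpl; [now constructor |].
  eapply ev_precS; eauto.
Qed.

Lemma cp_mu G h :
  cp G ->
  (forall i n, G i (pr n (h i n)) = 0) ->
  (forall i n k, k < h i n -> G i (pr n k) <> 0) ->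
  cp h.
Proof.
  intros [c Hc] H0 H1; exists (Mu c); intros i n; constructor.
  - intros k Hk; exists (pred (G i (pr n k))).
    specialize (H1 i n k Hk).
    replace (S (pred (G i (pr n k)))) with (G i (pr n k)) by lia; auto.
  - rewrite <- (H0 i n); auto.
Qed.

Lemma cp_pred F : cp F -> cp (fun i n => pred (F i n)).
Proof.
  intros HF.
  apply cp_ext with (fun i n => prim (fun q => p1 (p2 q)) n 0 (F i n)).
  - intros; destruct (F i n); simpl; now rewrite ?p2_pr, ?p1_pr.
  - apply (cp_prim (fun _ q => _)); auto using cp_const, cp_p1, cp_p2, cp_id.
Qed.

Lemma cp_add F G : cp F -> cp G -> cp (fun i n => F i n + G i n).
Proof.
  intros HF HG.
  apply cp_ext with
    (fun i n => prim (fun q => S (p2 (p2 q))) n (F i n) (G i n)).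
  - intros; induction (G i n) as [| k IH]; simpl; [lia |].
    rewrite !p2_pr, IH; lia.
  - apply (cp_prim (fun _ q => _)); auto using cp_S, cp_p2, cp_id.
Qed.

Lemma cp_sub F G : cp F -> cp G -> cp (fun i n => F i n - G i n).
Proof.
  intros HF HG.
  apply cp_ext with
    (fun i n => prim (fun q => pred (p2 (p2 q))) n (F i n) (G i n)).
  - intros; induction (G i n) as [| k IH]; simpl; [lia |].
    rewrite !p2_pr, IH; lia.
  - apply (cp_prim (fun _ q => _)); auto using cp_pred, cp_p2, cp_id.
Qed.

Lemma cp_mul F G : cp F -> cp G -> cp (fun i n => F i n * G i n).
Proof.
  intros HF HG.
  apply cp_ext with
    (fun i n => prim (fun q => p2 (p2 q) + F i (p1 q)) n 0 (G i n)).
  - intros; induction (G i n) as [| k IH]; cbn [prim]; [lia |].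
    rewrite !p2_pr, p1_pr, IH; lia.
  - apply (cp_prim (fun i q => p2 (p2 q) + F i (p1 q))); auto using cp_const.
    apply cp_add; [auto using cp_p2, cp_id |].
    apply cp_comp; auto using cp_p1, cp_id.
Qed.

Lemma cp_pow b F : cp F -> cp (fun i n => b ^ F i n).
Proof.
  intros HF.
  apply cp_ext with (fun i n => prim (fun q => b * p2 (p2 q)) n 1 (F i n)).
  - intros; induction (F i n) as [| k IH]; simpl; [lia |].
    now rewrite !p2_pr, IH.
  - apply (cp_prim (fun _ q => _)); auto using cp_const, cp_mul, cp_p2, cp_id.
Qed.

Lemma cpb_eqb F G : cp F -> cp G -> cpb (fun i n => F i n =? G i n).
Proof.
  intros HF HG; unfold cpb.
  (* The two truncated differences add up to the distance, and [1 - d] is the truth value of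
     [d = 0]. *)
  apply cp_ext with (fun i n => 1 - ((F i n - G i n) + (G i n - F i n))).
  - intros; destruct (Nat.eqb_spec (F i n) (G i n)); cbn [Nat.b2n]; lia.
  - auto using cp_sub, cp_add, cp_const.
Qed.

Lemma cpb_leb F G : cp F -> cp G -> cpb (fun i n => F i n <=? G i n).
Proof.
  intros HF HG; unfold cpb.
  apply cp_ext with (fun i n => Nat.b2n (F i n - G i n =? 0)).
  - intros; f_equal; destruct (Nat.leb_spec (F i n) (G i n)).
    + apply Nat.eqb_eq; lia.
    + apply Nat.eqb_neq; lia.
  - apply cpb_eqb; auto using cp_sub, cp_const.
Qed.

Lemma cpb_negb P : cpb P -> cpb (fun i n => negb (P i n)).
Proof.
  intros HP; unfold cpb; apply cp_ext with (fun i n => 1 - Nat.b2n (P i n)).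
  - intros; now destruct (P i n).
  - auto using cp_sub, cp_const.
Qed.

Lemma cpb_andb P Q : cpb P -> cpb Q -> cpb (fun i n => P i n && Q i n).
Proof.
  intros HP HQ; unfold cpb.
  apply cp_ext with (fun i n => Nat.b2n (P i n) * Nat.b2n (Q i n)).
  - intros; now destruct (P i n), (Q i n).
  - now apply cp_mul.
Qed.

Lemma cpb_orb P Q : cpb P -> cpb Q -> cpb (fun i n => P i n || Q i n).
Proof.
  intros HP HQ; unfold cpb.
  apply cp_ext with (fun i n => Nat.b2n (negb (negb (P i n) && negb (Q i n)))).
  - intros; now destruct (P i n), (Q i n).
  - apply cpb_negb, cpb_andb; now apply cpb_negb.
Qed.

Lemma cpb_implb P Q : cpb P -> cpb Q -> cpb (fun i n => implb (P i n) (Q i n)).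
Proof.
  intros HP HQ; unfold cpb.
  apply cp_ext with (fun i n => Nat.b2n (negb (P i n) || Q i n)).
  - intros; now destruct (P i n), (Q i n).
  - apply cpb_orb; trivial; now apply cpb_negb.
Qed.

Lemma cp_if P F G :
  cpb P -> cp F -> cp G -> cp (fun i n => if P i n then F i n else G i n).
Proof.
  intros HP HF HG.
  apply cp_ext with
    (fun i n => Nat.b2n (P i n) * F i n + (1 - Nat.b2n (P i n)) * G i n).
  - intros; destruct (P i n); simpl; lia.
  - auto using cp_add, cp_mul, cp_sub, cp_const.
Qed.

Lemma cpb_if P Q R :
  cpb P -> cpb Q -> cpb R -> cpb (fun i n => if P i n then Q i n else R i n).
Proof.
  intros HP HQ HR; unfold cpb.
  apply cp_ext with
    (fun i n => if P i n then Nat.b2n (Q i n) else Nat.b2n (R i n)).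
  - intros; now destruct (P i n).
  - now apply cp_if.
Qed.

Lemma cpb_odd F : cp F -> cpb (fun i n => Nat.odd (F i n)).
Proof.
  intros HF; unfold cpb.
  apply cp_ext with (fun i n => prim (fun q => 1 - p2 (p2 q)) n 0 (F i n)).
  - intros; induction (F i n) as [| k IH]; [easy |]; cbn [prim].
    rewrite !p2_pr, IH, Nat.odd_succ, <- Nat.negb_odd.
    now destruct (Nat.odd k).
  - apply (cp_prim (fun _ q => _)); auto using cp_const, cp_sub, cp_p2, cp_id.
Qed.

Lemma cp_div2 F : cp F -> cp (fun i n => Nat.div2 (F i n)).
Proof.
  intros HF.
  apply cp_ext with (fun i n =>
    prim (fun q => p2 (p2 q) + Nat.b2n (Nat.odd (p1 (p2 q)))) n 0 (F i n)).
  - intros; induction (F i n) as [| k IH]; [easy |]; cbn [prim].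
    rewrite !p2_pr, p1_pr, IH.
    pose proof (Nat.div2_odd k); pose proof (Nat.div2_odd (S k)) as E.
    rewrite Nat.odd_succ, <- Nat.negb_odd in E.
    destruct (Nat.odd k); simpl in *; lia.
  - apply (cp_prim (fun _ q => _)); trivial; [| apply cp_const].
    apply cp_add; [auto using cp_p2, cp_id |].
    apply (cpb_odd (fun _ q => p1 (p2 q))); auto using cp_p1, cp_p2, cp_id.
Qed.

End Computable.

Create HintDb cp.
#[local] Hint Resolve cp_id cp_S cp_const cp_p1 cp_p2 cp_pr cp_pred cp_add
  cp_sub cp_mul cp_pow cp_if cp_div2 cp_oracle
  cpb_eqb cpb_leb cpb_negb cpb_andb cpb_orb cpb_implb cpb_if cpb_odd : cp.

(** * Turing reducibility *)

Lemma le_T_cp X Y : le_T X Y <-> cp (fun _ : unit => Y) (fun _ => chi X).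
Proof.
  split.
  - intros [c H]; exists c; intros _ n; unfold chi.
    now destruct excluded_middle_informative; apply H.
  - intros [c H]; exists c; intros n; split; intros Hn;
      [rewrite <- (chi_in X n Hn) | rewrite <- (chi_out X n Hn)];
      apply (H tt).
Qed.

Fixpoint subst_oracle (d c : code) : code :=
  match c with
  | Oracle => d
  | Pair f g => Pair (subst_oracle d f) (subst_oracle d g)
  | Comp f g => Comp (subst_oracle d f) (subst_oracle d g)
  | Prec f g => Prec (subst_oracle d f) (subst_oracle d g)
  | Mu f => Mu (subst_oracle d f)
  | _ => c
  end.

Lemma eval_subst_oracle X Y d :
  (forall n, eval Y d n (chi X n)) ->
  forall c n m, eval X c n m -> eval Y (subst_oracle d c) n m.
Proof.
  intros Hd c.
  induction c as [| | | | | f IHf g IHg | f IHf g IHg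
                 | f IHf g IHg | f IHf]; intros n m H; simpl.
  (* In the [Prec] case the recursive call has the same code, so an inner induction on the recursion
     counter is needed. *)
  8: {
    rewrite <- (pr_p n) in H |- *; revert m H.
    induction (p2 n) as [| i IH]; intros m H; apply eval_Prec_inv in H;
      destruct H as [(x & E & H) | (x & j & a & E & H & H')];
      apply pr_inj in E; destruct E as [E E']; try discriminate.
    - rewrite E; constructor; auto.
    - injection E' as <-; rewrite E in *; eapply ev_precS; eauto. }
  all: inversion H; subst; try (now constructor).
  - rewrite <- (chi_in X n) by trivial; auto.
  - rewrite <- (chi_out X n) by trivial; auto.
  - constructor; auto.
  - econstructor; eauto.
  - constructor; auto.
    match goal with F : forall i, _ < _ -> _ |- _ =>
      intros i Hi; destruct (F i Hi); eauto end.
Qed.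

Lemma le_T_refl X : le_T X X.
Proof. apply le_T_cp; apply (cp_oracle (fun _ => X)), cp_id. Qed.

Lemma le_T_trans X Y Z : le_T X Y -> le_T Y Z -> le_T X Z.
Proof.
  rewrite !le_T_cp; intros [c Hc] [d Hd].
  exists (subst_oracle d c); intros i n.
  apply (eval_subst_oracle Y); [exact (Hd tt) | exact (Hc tt n)].
Qed.

Lemma join_even X Y n : join X Y (2 * n) <-> X n.
Proof.
  split; [intros (k & [[E H] | [E _]]) | exists n; auto].
  - now replace n with k by lia.
  - lia.
Qed.

Lemma join_odd X Y n : join X Y (S (2 * n)) <-> Y n.
Proof.
  split; [intros (k & [[E _] | [E H]]) | exists n; right; split; trivial; lia].
  - lia.
  - now replace n with k by lia.
Qed.

Lemma chi_iff X Y n m : (X n <-> Y m) -> chi X n = chi Y m.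
Proof. unfold chi; do 2 destruct excluded_middle_informative; tauto. Qed.

Lemma chi_join X Y m :
  chi (join X Y) m =
  if Nat.odd m then chi Y (Nat.div2 m) else chi X (Nat.div2 m).
Proof.
  pose proof (Nat.div2_odd m) as E; destruct (Nat.odd m); simpl Nat.b2n in E;
    apply chi_iff; rewrite E at 1.
  - rewrite Nat.add_1_r; apply join_odd.
  - rewrite Nat.add_0_r; apply join_even.
Qed.

Lemma le_T_join_r X Y : le_T Y (join X Y).
Proof.
  apply le_T_cp.
  apply cp_ext with (fun _ n => chi (join X Y) (S (2 * n))).
  - intros _ n; apply chi_iff, join_odd.
  - apply (cp_oracle (fun _ : unit => join X Y)); auto with cp.
Qed.

Lemma join_le_T X Y Z : le_T X Z -> le_T Y Z -> le_T (join X Y) Z.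
Proof.
  rewrite !le_T_cp; intros HX HY.
  apply cp_ext with (fun _ m =>
    if Nat.odd m then chi Y (Nat.div2 m) else chi X (Nat.div2 m)).
  - intros _ m; symmetry; apply chi_join.
  - apply cp_if; [auto with cp | |].
    + apply (cp_comp _ (fun _ : unit => chi Y)); auto with cp.
    + apply (cp_comp _ (fun _ : unit => chi X)); auto with cp.
Qed.

Lemma empty_le_T X : le_T empty X.
Proof. exists Zero; split; [easy | constructor]. Qed.

#[local] Opaque pr p1 p2.

(** * A universal evaluator with fuel *)

(* [T] tabulates the evaluator at the previous fuel, with values shifted by
   one so that [0] means divergence.  Besides the tags of [encode] there are
   two auxiliary ones: [pr 9 e] at [pr x k] runs the search of [Mu] from [k]
   on, and [pr 10 e] tests whether [e] is the code of a program. *)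
Definition ev_step (q T : nat -> nat) (e n : nat) : nat :=
  if p1 e =? 10 then
    if p1 (p2 e) <=? 4 then (if p2 (p2 e) =? 0 then 1 else 0)
    else if p1 (p2 e) <=? 7 then
      if T (pr (pr 10 (p1 (p2 (p2 e)))) 0) =? 0 then 0
      else T (pr (pr 10 (p2 (p2 (p2 e)))) 0)
    else if p1 (p2 e) =? 8 then T (pr (pr 10 (p2 (p2 e))) 0)
    else 0
  else if p1 e =? 9 then
    if T (pr (pr 10 (p2 e)) 0) =? 0 then 0
    else if T (pr (p2 e) n) =? 0 then 0
    else if T (pr (p2 e) n) =? 1 then S (p2 n)
    else T (pr e (pr (p1 n) (S (p2 n))))
  else if T (pr (pr 10 e) 0) =? 0 then 0
  else if p1 e =? 0 then 1
  else if p1 e =? 1 then S (S n)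
  else if p1 e =? 2 then S (p1 n)
  else if p1 e =? 3 then S (p2 n)
  else if p1 e =? 4 then S (q n)
  else if p1 e =? 5 then
    if T (pr (p1 (p2 e)) n) =? 0 then 0
    else if T (pr (p2 (p2 e)) n) =? 0 then 0
    else S (pr (pred (T (pr (p1 (p2 e)) n))) (pred (T (pr (p2 (p2 e)) n))))
  else if p1 e =? 6 then
    if T (pr (p2 (p2 e)) n) =? 0 then 0
    else T (pr (p1 (p2 e)) (pred (T (pr (p2 (p2 e)) n))))
  else if p1 e =? 7 then
    if p2 n =? 0 then T (pr (p1 (p2 e)) (p1 n))
    else if T (pr e (pr (p1 n) (pred (p2 n)))) =? 0 then 0
    else T (pr (p2 (p2 e))
              (pr (p1 n) (pr (pred (p2 n))
                             (pred (T (pr e (pr (p1 n) (pred (p2 n)))))))))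
  else T (pr (pr 9 (p2 e)) (pr n 0)).

(** With the recursion confined to the argument [T], each fuel level is one application of [ev_step]
    to the level before; a claimed table of [ev] can thus be verified entry by entry. *)
Fixpoint ev (q : nat -> nat) (s e n : nat) : nat :=
  match s with
  | 0 => 0
  | S s => ev_step q (fun p => ev q s (p1 p) (p2 p)) e n
  end.

(** A query of [T] answered by [0] makes the step return [0]; a nonzero result rests on nonzero
    answers alone, and [T'] repeats these. *)
Lemma ev_step_mono q T T' e n m :
  (forall p v, T p = S v -> T' p = S v) ->
  ev_step q T e n = S m -> ev_step q T' e n = S m.
Proof.
  intros H.
  assert (H' : forall p, T p = 0 \/ T p = T' p).
  { intros p; specialize (H p); destruct (T p); [auto |].
    right; symmetry; auto. }
  unfold ev_step.
  repeat match goal with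
  | |- context [if ?b then _ else _] =>
    lazymatch b with
    | context [T ?p] =>
        let E := fresh in
        destruct (H' p) as [E | E]; [rewrite E; easy | rewrite E]
    | _ => destruct b
    end; auto
  end.
Qed.

Lemma ev_mono q s t e n m : s <= t -> ev q s e n = S m -> ev q t e n = S m.
Proof.
  intros L; revert e n m; induction L as [| t L IH]; trivial.
  intros e n m H; apply IH in H; clear IH L.
  revert e n m H; induction t as [| t IH]; [easy |].
  intros e n m; apply ev_step_mono; intros p v; apply IH.
Qed.

Lemma ev_step_ext q T T' e n :
  (forall p, T p = T' p) -> ev_step q T e n = ev_step q T' e n.
Proof. intros H; unfold ev_step; now rewrite !H. Qed.

(** What an answer [S m] asserts. Under tag 9, [m] is the first zero at or after [p2 n]; under tag
    10 only the existence of a program matters. *)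
Definition ev_sem (X : real) (e n m : nat) : Prop :=
  if p1 e =? 9 then
    exists c, encode c = p2 e /\ p2 n <= m /\ eval X c (pr (p1 n) m) 0 /\
      forall i, p2 n <= i < m -> exists v, eval X c (pr (p1 n) i) (S v)
  else if p1 e =? 10 then exists c, encode c = p2 e
  else phi X e n m.

Lemma ev_sem_9 X b n m :
  ev_sem X (pr 9 b) n m <->
  exists c, encode c = b /\ p2 n <= m /\ eval X c (pr (p1 n) m) 0 /\
    forall i, p2 n <= i < m -> exists v, eval X c (pr (p1 n) i) (S v).
Proof. unfold ev_sem; now rewrite p1_pr, p2_pr. Qed.

Lemma ev_sem_10 X b n m : ev_sem X (pr 10 b) n m <-> exists c, encode c = b.
Proof. unfold ev_sem; now rewrite p1_pr, p2_pr. Qed.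

Lemma encode_tag c : p1 (encode c) <= 8.
Proof. destruct c; simpl; rewrite p1_pr; lia. Qed.

Lemma ev_sem_phi X e n m : p1 e <= 8 -> ev_sem X e n m <-> phi X e n m.
Proof.
  intros H; unfold ev_sem.
  destruct (Nat.eqb_spec (p1 e) 9); [lia |].
  destruct (Nat.eqb_spec (p1 e) 10); [lia | easy].
Qed.

Lemma split_code e t : p1 e = t -> e = pr t (p2 e).
Proof. intros <-; now rewrite pr_p. Qed.

(** * Soundness and completeness of the evaluator *)

Section Evaluator.
Context (X : real) (q : nat -> nat) (Hq : forall n, q n = chi X n).

Lemma ev_sound s e n m : ev q s e n = S m -> ev_sem X e n m.
Proof.
  revert e n m; induction s as [| s IHs]; [easy |].
  intros e n m H; cbn [ev] in H.
  set (T := fun p => ev q s (p1 p) (p2 p)) in H.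
  (* From here on all that is kept of the previous table is that its nonzero entries are sound. *)
  assert (IH : forall a b v, T (pr a b) = S v -> ev_sem X a b v).
  { intros a b v; unfold T; rewrite p1_pr, p2_pr; apply IHs. }
  clearbody T; clear IHs s; unfold ev_step in H.
  destruct (Nat.eqb_spec (p1 e) 10) as [E | _].
  { apply split_code in E; revert H; rewrite E, ev_sem_10, p2_pr.
    generalize (p2 e) as b; clear E e; intros b H.
    destruct (Nat.leb_spec (p1 b) 4) as [E | E4].
    { destruct (Nat.eqb_spec (p2 b) 0) as [E0 | _]; [| easy].
      rewrite <- (pr_p b), E0.
      destruct (p1 b) as [| [| [| [| [|]]]]];
        [exists Zero | exists Succ | exists Fst | exists Snd
        | exists Oracle | lia];
        trivial. }
    destruct (Nat.leb_spec (p1 b) 7) as [E | _].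
    { destruct (T (pr (pr 10 (p1 (p2 b))) 0)) eqn:H1;
        [easy | cbn [Nat.eqb] in H].
      apply IH, ev_sem_10 in H as [d Hd].
      apply IH, ev_sem_10 in H1 as [c Hc].
      rewrite <- (pr_p b), <- (pr_p (p2 b)), <- Hd, <- Hc.
      assert (C : p1 b = 5 \/ p1 b = 6 \/ p1 b = 7) by lia.
      destruct C as [-> | [-> | ->]];
        [exists (Pair c d) | exists (Comp c d) | exists (Prec c d)]; trivial. }
    destruct (Nat.eqb_spec (p1 b) 8) as [E | _]; [| easy].
    apply IH, ev_sem_10 in H as [c Hc].
    exists (Mu c); simpl; now rewrite Hc, <- E, pr_p. }
  destruct (Nat.eqb_spec (p1 e) 9) as [E | E9].
  { apply split_code in E; revert H; rewrite E, ev_sem_9, p2_pr.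
    generalize (p2 e) as b; clear E e; intros b H.
    destruct (T (pr (pr 10 b) 0)) eqn:Hb; [easy |].
    apply IH, ev_sem_10 in Hb as [c <-].
    destruct (T (pr (encode c) n)) as [| v] eqn:H1; [easy |].
    apply IH, ev_sem_phi in H1 as [d [E H1]]; [| apply encode_tag].
    apply encode_inj in E as ->; exists c; split; trivial.
    cbn [Nat.eqb] in H; rewrite <- (pr_p n) in H1.
    destruct (Nat.eqb_spec v 0) as [-> | Hv].
    - injection H as <-; repeat split; trivial; lia.
    - apply IH, ev_sem_9 in H as [d [E H]]; apply encode_inj in E as ->.
      rewrite p1_pr, p2_pr in H; destruct H as (L & H & F).
      repeat split; [lia | trivial |]; intros i Hi.
      destruct (Nat.eq_dec i (p2 n)) as [-> | N]; [| apply F; lia].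
      exists (pred v); now replace (S (pred v)) with v by lia. }
  destruct (T (pr (pr 10 e) 0)) eqn:He; [easy | cbn [Nat.eqb] in H].
  apply IH, ev_sem_10 in He as [c <-]; clear E9.
  apply ev_sem_phi; [apply encode_tag |]; exists c; split; trivial.
  assert (IHc : forall d b v, T (pr (encode d) b) = S v -> eval X d b v).
  { intros d b v Hd; apply IH, ev_sem_phi in Hd as (d' & E & Hd);
      [now apply encode_inj in E as -> | apply encode_tag]. }
  destruct c as [| | | | | f g | f g | f g | f]; cbn [encode] in H;
    rewrite ?p1_pr, ?p2_pr, ?p1_pr in H; cbn [Nat.eqb] in H.
  - injection H as <-; constructor.
  - injection H as <-; constructor.
  - injection H as <-; rewrite <- (pr_p n) at 1; constructor.
  - injection H as <-; rewrite <- (pr_p n) at 1; constructor.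
  - injection H as <-; rewrite Hq; apply eval_Oracle.
  - destruct (T (pr (encode f) n)) eqn:Hf; [easy |].
    destruct (T (pr (encode g) n)) eqn:Hg; [easy |].
    injection H as <-; constructor; auto.
  - destruct (T (pr (encode g) n)) eqn:Hg; [easy |].
    econstructor; eauto.
  - rewrite <- (pr_p n); destruct (p2 n) as [| i]; cbn [Nat.eqb pred] in H.
    + constructor; auto.
    + change (pr 7 (pr (encode f) (encode g))) with (encode (Prec f g)) in H.
      destruct (T (pr (encode (Prec f g)) (pr (p1 n) i))) eqn:Hi; [easy |].
      eapply ev_precS; eauto.
  - apply IH, ev_sem_9 in H as (d & E & H); apply encode_inj in E as ->.
    rewrite p1_pr, p2_pr in H; destruct H as (_ & H & F).
    constructor; auto with arith.
Qed.

(** Asking for the answer at all large fuels lets the bounds of several subcomputations be combined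
    by addition. *)
Definition ev_lim (e n m : nat) : Prop :=
  exists s0, forall s, s0 <= s -> ev q s e n = S m.

Ltac ev_unfold :=
  cbn [ev encode]; unfold ev_step; repeat rewrite ?p1_pr, ?p2_pr;
  cbn [Nat.eqb Nat.leb].

Ltac ev_at k :=
  exists (S k); intros [| s] L; [lia |]; ev_unfold.

Lemma ev_lim_code c n : ev_lim (pr 10 (encode c)) n 0.
Proof.
  revert n; induction c as [| | | | | f IHf g IHg | f IHf g IHg
                  | f IHf g IHg | f IHf]; intros n;
    try (now exists 1; intros [| s] L; [lia | ev_unfold]);
    destruct (IHf 0) as [sf Hf]; try destruct (IHg 0) as [sg Hg].
  all: try (ev_at (sf + sg); rewrite Hf by lia; apply Hg; lia).
  ev_at sf; rewrite Hf by lia; easy.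
Qed.

Lemma ev_complete c n m : eval X c n m -> ev_lim (encode c) n m.
Proof.
  revert n m; induction c as [| | | | | f IHf g IHg | f IHf g IHg
                  | f IHf g IHg | f IHf]; intros n m H.
  8: {
    destruct (ev_lim_code (Prec f g) 0) as [sc Hc]; cbn [encode] in Hc.
    rewrite <- (pr_p n) in H |- *; revert m H.
    induction (p2 n) as [| i IH]; intros m H; apply eval_Prec_inv in H;
      destruct H as [(x & E & H) | (x & j & a & E & H & H')];
      apply pr_inj in E; destruct E as [E E']; try discriminate.
    - apply IHf in H as [s1 H1]; ev_at (sc + s1).
      rewrite Hc by lia; cbn [Nat.eqb]; rewrite E; apply H1; lia.
    - injection E' as <-; rewrite E in *.
      apply IH in H as [s1 H1]; apply IHg in H' as [s2 H2].
      cbn [encode] in H1; ev_at (sc + s1 + s2).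
      rewrite Hc by lia; cbn [Nat.eqb pred]; rewrite H1 by lia.
      apply H2; lia. }
  all: match goal with |- ev_lim (encode ?c) _ _ =>
         destruct (ev_lim_code c 0) as [sc Hc]; cbn [encode] in Hc end.
  all: inversion H; subst; clear H.
  1-6: ev_at sc; rewrite Hc by lia; cbn [Nat.eqb];
       rewrite ?p1_pr, ?p2_pr, ?Hq, ?chi_in, ?chi_out by trivial; easy.
  - match goal with A : eval X f _ _, B : eval X g _ _ |- _ =>
      apply IHf in A as [s1 H1]; apply IHg in B as [s2 H2] end.
    ev_at (sc + s1 + s2); rewrite Hc, H1, H2 by lia; easy.
  - match goal with A : eval X f _ _, B : eval X g _ _ |- _ =>
      apply IHg in B as [s1 H1]; apply IHf in A as [s2 H2] end.
    ev_at (sc + s1 + s2); rewrite Hc, H1 by lia; cbn [Nat.eqb pred].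
    apply H2; lia.
  - match goal with
    | A : eval X f _ _, B : forall i, _ < _ -> exists _, _ |- _ =>
        apply IHf in A as [s0 H0]; rename B into F
    end.
    (* The search is followed backwards from its result: [d] is the distance from the current
       position [k] to the zero [m]. *)
    assert (R : forall d k, k + d = m -> ev_lim (pr 9 (encode f)) (pr n k) m).
    { destruct (ev_lim_code f 0) as [sf Hf].
      induction d as [| d IHd]; intros k E.
      - replace m with k in * by lia; ev_at (sf + s0).
        rewrite Hf, H0 by lia; easy.
      - destruct (F k) as [v Hv]; [lia |]; apply IHf in Hv as [s1 Hv].
        destruct (IHd (S k)) as [s2 H2]; [lia |]; ev_at (sf + s1 + s2).
        rewrite Hf, Hv by lia; cbn [Nat.eqb]; apply H2; lia. }
    destruct (R m 0) as [s1 H2]; trivial.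
    ev_at (sc + s1); rewrite Hc by lia; cbn [Nat.eqb]; apply H2; lia.
Qed.

(** Cutting off the auxiliary tags leaves exactly the convergent computations of [phi], also on
    numbers that code no program. *)
Definition run (s e n : nat) : nat := if p1 e <=? 8 then ev q s e n else 0.

Lemma run_mono s t e n m : s <= t -> run s e n = S m -> run t e n = S m.
Proof. unfold run; destruct (p1 e <=? 8); [apply ev_mono | easy]. Qed.

Lemma run_phi s e n m : run s e n = S m -> phi X e n m.
Proof.
  unfold run; destruct (Nat.leb_spec (p1 e) 8); [| easy].
  intros H'; apply ev_sound, ev_sem_phi in H'; trivial.
Qed.

Lemma phi_run e n m : phi X e n m -> exists s, run s e n = S m.
Proof.
  intros (c & <- & H); apply ev_complete in H as [s H]; exists s.
  unfold run; pose proof (encode_tag c) as L; apply Nat.leb_le in L.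
  rewrite L; auto.
Qed.

End Evaluator.

(** * Kleene's O as an inductive definition *)

Lemma phi_functional X e n m m' : phi X e n m -> phi X e n m' -> m = m'.
Proof.
  intros (c & <- & H) (d & E & H'); apply encode_inj in E as ->.
  eapply eval_functional; eauto.
Qed.

Lemma pow2_inj a b : 2 ^ a = 2 ^ b -> a = b.
Proof. apply Nat.pow_inj_r; lia. Qed.

Lemma odd_pow b n : Nat.odd b = true -> Nat.odd (b ^ n) = true.
Proof. intros H; induction n; simpl; [easy | now rewrite Nat.odd_mul, H]. Qed.

Lemma lim_index_inj e d : 3 * 5 ^ e = 3 * 5 ^ d -> e = d.
Proof. intros H; apply (Nat.pow_inj_r 5); lia. Qed.

Lemma lim_index_ge e : 3 <= 3 * 5 ^ e.
Proof. pose proof (Nat.pow_nonzero 5 e); lia. Qed.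

Scheme KleeneO_lt_ind := Minimality for KleeneO Sort Prop
  with ltO_O_ind := Minimality for ltO Sort Prop.

(** Limit notations are odd and at least [3]; the only odd power of two is [1]. *)
Lemma pow2_lim_index a e : 2 ^ a <> 3 * 5 ^ e.
Proof.
  intros H; pose proof (lim_index_ge e).
  destruct a as [| a]; [simpl in *; lia |].
  apply (f_equal Nat.odd) in H.
  now rewrite Nat.odd_mul, (odd_pow 5), Nat.pow_succ_r', Nat.odd_mul in H.
Qed.

Lemma KleeneO_nonzero X a : KleeneO X a -> a <> 0.
Proof.
  intros H; inversion H; subst; [easy | |].
  - apply Nat.pow_nonzero; lia.
  - pose proof (lim_index_ge e); lia.
Qed.

Lemma KleeneO_lim_inv X e :
  KleeneO X (3 * 5 ^ e) ->
  exists s, (forall n, phi X e n (s n)) /\ (forall n, KleeneO X (s n)) /\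
            (forall n, ltO X (s n) (s (S n))).
Proof.
  pose proof (lim_index_ge e) as G.
  intros H; inversion H as [E | a Ha E | d s H1 H2 H3 E].
  - lia.
  - now apply pow2_lim_index in E.
  - apply lim_index_inj in E as ->; eauto.
Qed.

(* The premise of the limit rule for [e], at stage [n]. *)
Definition climbs (X : real) (C : nat -> Prop) (L : nat -> nat -> Prop)
    (e n : nat) : Prop :=
  exists a b, phi X e n a /\ phi X e (S n) b /\ C a /\ L a b.

(* Closure under the rules of O, together with an inversion principle for
   [L]: along O the latter has only one solution. *)
Record good (X : real) (C : nat -> Prop) (L : nat -> nat -> Prop) : Prop := {
  good_one : C 1;
  good_suc a : C a -> C (2 ^ a);
  good_lt_suc a : C a -> L a (2 ^ a);
  good_lt_lim e i a : C (3 * 5 ^ e) -> phi X e i a -> L a (3 * 5 ^ e);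
  good_trans a b c : L a b -> L b c -> L a c;
  good_lim e : (forall n, climbs X C L e n) -> C (3 * 5 ^ e);
  good_lt_inv a b : L a b ->
    exists x, (a = x \/ L a x) /\
      ((b = 2 ^ x /\ x <> 0) \/ exists e i, b = 3 * 5 ^ e /\ phi X e i x) }.

(** [O_lim] wants a sequence, whereas [climbs] gives two values per stage; as [phi] is single
    valued, the pairs of consecutive stages overlap consistently and form one. *)
Lemma KleeneO_climbs X e :
  (forall n, climbs X (KleeneO X) (ltO X) e n) -> KleeneO X (3 * 5 ^ e).
Proof.
  intros H.
  set (s := fun n => epsilon (inhabits 0) (fun a => phi X e n a)).
  assert (Hs : forall n a, phi X e n a -> s n = a).
  { intros n a Ha; apply phi_functional with X e n; trivial.
    apply epsilon_spec; eauto. }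
  apply O_lim with s; intros n; destruct (H n) as (a & b & Ha & Hb & Oa & Lab).
  - now rewrite (Hs n a).
  - now rewrite (Hs n a).
  - now rewrite (Hs n a), (Hs (S n) b).
Qed.

Lemma good_KleeneO X : good X (KleeneO X) (ltO X).
Proof.
  split.
  - constructor.
  - now constructor.
  - now constructor.
  - intros e i a H Ha; destruct (KleeneO_lim_inv _ _ H) as (s & H1 & H2 & H3).
    rewrite (phi_functional _ _ _ _ _ Ha (H1 i)); now apply ltO_lim.
  - apply ltO_trans.
  - apply KleeneO_climbs.
  - intros a b H; induction H as [a Ha | e s n H1 H2 H3 | a b c H1 _ H2 IH].
    + exists a; split; auto; left; split; trivial.
      eapply KleeneO_nonzero; eauto.
    + exists (s n); split; eauto.
    + destruct IH as (x & [-> | Hx] & H); exists x; split;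
        eauto using ltO_trans.
Qed.

(** Mutual induction with [C] and [L] as the motives: the closure rules of [good] are its cases. *)
Lemma good_KleeneO_sub X C L k : good X C L -> KleeneO X k -> C k.
Proof.
  intros G; apply KleeneO_lt_ind with (P0 := L).
  - apply G.
  - intros a _; apply G.
  - intros e s H1 _ H2 _ H3; apply (good_lim _ _ _ G); intros n.
    exists (s n), (s (S n)); auto.
  - intros a _; apply G.
  - intros e s n H1 _ H2 _ H3; apply (good_lt_lim _ _ _ G) with n; trivial.
    apply (good_lim _ _ _ G); intros i; exists (s i), (s (S i)); auto.
  - intros a b c _ H1 _ H2; eapply (good_trans _ _ _ G); eauto.
Qed.

(** Induction on the notation [y]: the inversion principle leads from [y] to a [z] that is truly
    below it, with [x] equal to [z] or [L]-below it, and the induction hypothesis takes over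
    there. *)
Lemma good_ltO X C L x y : good X C L -> KleeneO X y -> L x y -> ltO X x y.
Proof.
  intros G Hy; revert x; induction Hy as [| a Ha IH | e s H1 H2 IH H3];
    intros x H; destruct (good_lt_inv _ _ _ G _ _ H)
      as (z & Hz & [[E N] | (d & i & E & Hd)]).
  (* As [2 ^ 0 = 1], only the clause [x <> 0] of the inversion keeps the notation [1] minimal. *)
  - destruct z; [easy |].
    pose proof (Nat.pow_gt_1 2 (S z)); lia.
  - pose proof (lim_index_ge d); lia.
  - apply pow2_inj in E as <-.
    destruct Hz as [-> | Hz]; eauto using ltO_trans, ltO_suc.
  - now apply pow2_lim_index in E.
  - symmetry in E; now apply pow2_lim_index in E.
  - apply lim_index_inj in E as <-.
    rewrite (phi_functional _ _ _ _ _ Hd (H1 i)) in Hz.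
    assert (ltO X (s i) (3 * 5 ^ e)) by now apply ltO_lim.
    destruct Hz as [-> | Hz]; eauto using ltO_trans.
Qed.

(** The gain is a purely existential form. O and its order serve as witnesses from left to right;
    for the converse, any good pair contains O and is correct for the order below members of O. *)
Lemma not_KleeneO_iff X (Y : nat -> Prop) :
  ~ (forall k, Y k <-> KleeneO X k) <->
  exists C L, good X C L /\
    ((exists k, Y k /\ ~ C k) \/ ~ Y 1 \/ (exists a, Y a /\ ~ Y (2 ^ a)) \/
     (exists e, ~ Y (3 * 5 ^ e) /\ forall n, climbs X Y L e n)).
Proof.
  split.
  - intros N; exists (KleeneO X), (ltO X); split; [apply good_KleeneO |].
    apply NNPP; intros F; apply N.
    assert (YO : forall k, Y k -> KleeneO X k).
    { intros k Hk; apply NNPP; intros Hn; apply F; eauto. }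
    intros k; split; [auto |].
    apply KleeneO_lt_ind with (P0 := fun _ _ => True); trivial.
    + apply NNPP; intros Hn; apply F; auto.
    + intros a _ Ha; apply NNPP; intros Hn; apply F; eauto 6.
    + intros e s H1 H2 H3 H4 _; apply NNPP; intros Hn; apply F.
      do 3 right; exists e; split; trivial; intros n.
      exists (s n), (s (S n)); auto.
  - intros (C & L & G & H) E.
    destruct H as [(k & Hk & N) | [N | [(a & Ha & N) | (e & N & H)]]].
    + apply N, (good_KleeneO_sub _ _ _ _ G), E, Hk.
    + apply N, E; constructor.
    + apply N, E; constructor; now apply E.
    + apply N, E, KleeneO_climbs; intros n.
      destruct (H n) as (a & b & Ha & Hb & Ya & Lab).
      exists a, b; repeat split; trivial; [now apply E |].
      apply (good_ltO _ _ _ _ _ G); trivial.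
      (* [b] is also the first value of the next stage, which puts it into [Y] and hence into O. *)
      destruct (H (S n)) as (b' & _ & Hb' & _ & Yb & _).
      rewrite (phi_functional _ _ _ _ _ Hb Hb'); now apply E.
Qed.

(** * The diagonal set and its normal form *)

Definition diag (X : real) (n : nat) : Prop :=
  (forall k, exists v, phi X n k v) /\
  (forall k, (exists v, phi X n k v /\ p1 v = 1) <-> KleeneO empty k) /\
  (exists v, phi X n n v /\ p2 v = 0).

Definition decide (P : Prop) : bool :=
  if excluded_middle_informative P then true else false.

Lemma decide_iff P : decide P = true <-> P.
Proof. unfold decide; destruct excluded_middle_informative; easy. Qed.

Definition choose (P : nat -> Prop) : nat := epsilon (inhabits 0) P.

Lemma choose_spec P : (exists x, P x) -> P (choose P).
Proof. apply epsilon_spec. Qed.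

(** [climbs] with running time [s]. Values of [R] are shifted by one, [0] meaning no value yet,
    hence the [pred]. *)
Definition climbs_at (R : nat -> nat -> nat -> nat) (C : nat -> bool)
    (L : nat -> nat -> bool) (s e n : nat) : bool :=
  negb (R s e n =? 0) && negb (R s e (S n) =? 0) &&
  C (pred (R s e n)) && L (pred (R s e n)) (pred (R s e (S n))).

(* [g] and [h] are Skolem functions for [good_lim] and [good_lt_inv]. *)
Definition check_good (R : nat -> nat -> nat -> nat) (C : nat -> bool)
    (L : nat -> nat -> bool) (g : nat -> nat) (h : nat -> nat -> nat)
    (a b c : nat) : bool :=
  C 1 && implb (C a) (C (2 ^ a)) && implb (C a) (L a (2 ^ a)) &&
  implb (C (3 * 5 ^ a) && negb (R b a c =? 0))
        (L (pred (R b a c)) (3 * 5 ^ a)) &&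
  implb (L a b && L b c) (L a c) &&
  (C (3 * 5 ^ a) || negb (climbs_at R C L b a (g a))) &&
  implb (L a b)
    (((a =? p1 (h a b)) || L a (p1 (h a b))) &&
     (((b =? 2 ^ p1 (h a b)) && negb (p1 (h a b) =? 0)) ||
      ((b =? 3 * 5 ^ p1 (p2 (h a b))) &&
       (R (p2 (p2 (p2 (h a b)))) (p1 (p2 (h a b))) (p1 (p2 (p2 (h a b))))
          =? S (p1 (h a b)))))).

(* The ways in which [diag X n] can fail, selected by [i]; [t] bounds the
   running times of [n] and [u] those of the sequence with index [w]. *)
Definition check_fail (R R' : nat -> nat -> nat -> nat) (C : nat -> bool)
    (L : nat -> nat -> bool) (t u : nat -> nat) (i w n a : nat) : bool :=
  if i =? 0 then R a n w =? 0
  else negb (R (t a) n a =? 0) &&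
    (if i =? 1 then negb (p2 (pred (R (t n) n n)) =? 0)
     else if i =? 2 then (p1 (pred (R (t w) n w)) =? 1) && negb (C w)
     else if i =? 3 then negb (p1 (pred (R (t 1) n 1)) =? 1)
     else if i =? 4 then
       (p1 (pred (R (t w) n w)) =? 1) &&
       negb (p1 (pred (R (t (2 ^ w)) n (2 ^ w))) =? 1)
     else
       negb (p1 (pred (R (t (3 * 5 ^ w)) n (3 * 5 ^ w))) =? 1) &&
       climbs_at R' (fun k => p1 (pred (R (t k) n k)) =? 1) L (u a) w a).

Lemma neq0_S v : (v =? 0) = false -> v = S (pred v).
Proof. intros H; apply Nat.eqb_neq in H; lia. Qed.

(** The variables are shared between clauses: next to [R], [a] is the index of a sequence, [b] a
    running time and [c] a stage. The number [h a b] packs an intermediate notation with the index,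
    stage and running time that certify it. *)
Lemma check_good_iff R C L g h a b c :
  check_good R C L g h a b c = true <->
  C 1 = true /\ (C a = true -> C (2 ^ a) = true) /\
  (C a = true -> L a (2 ^ a) = true) /\
  (C (3 * 5 ^ a) = true -> R b a c = S (pred (R b a c)) ->
   L (pred (R b a c)) (3 * 5 ^ a) = true) /\
  (L a b = true -> L b c = true -> L a c = true) /\
  (climbs_at R C L b a (g a) = true -> C (3 * 5 ^ a) = true) /\
  (L a b = true ->
     (a = p1 (h a b) \/ L a (p1 (h a b)) = true) /\
     ((b = 2 ^ p1 (h a b) /\ p1 (h a b) <> 0) \/
      (b = 3 * 5 ^ p1 (p2 (h a b)) /\
       R (p2 (p2 (p2 (h a b)))) (p1 (p2 (h a b))) (p1 (p2 (p2 (h a b))))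
         = S (p1 (h a b))))).
Proof.
  unfold check_good.
  rewrite !andb_true_iff, !implb_true_iff, !andb_true_iff, !orb_true_iff,
    !andb_true_iff, !negb_true_iff, !Nat.eqb_eq, !Nat.eqb_neq.
  assert (E : R b a c <> 0 <-> R b a c = S (pred (R b a c))) by lia.
  rewrite E; clear E.
  destruct (climbs_at R C L b a (g a)), (C (3 * 5 ^ a)); intuition congruence.
Qed.

(** * Skolemized form of non-membership in the diagonal set *)

Section Normal_form.
Context (X : real) (q q' : nat -> nat)
  (Hq : forall n, q n = chi X n) (Hq' : forall n, q' n = chi empty n).

Let R := run q.
Let R' := run q'.

Lemma climbs_at_iff (C : nat -> bool) (L : nat -> nat -> bool) e n :
  climbs empty (fun k => C k = true) (fun a b => L a b = true) e n <->
  exists s, climbs_at R' C L s e n = true.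
Proof.
  unfold climbs_at; split.
  - intros (a & b & Ha & Hb & HC & HL).
    apply (phi_run _ _ Hq') in Ha as [s Ha], Hb as [s' Hb].
    exists (s + s'); unfold R'.
    rewrite (run_mono _ s (s + s') _ _ _ ltac:(lia) Ha).
    rewrite (run_mono _ s' (s + s') _ _ _ ltac:(lia) Hb).
    cbn; now rewrite HC, HL.
  - intros [s H]; rewrite !andb_true_iff, !negb_true_iff in H.
    destruct H as [[[Ha Hb] HC] HL].
    exists (pred (R' s e n)), (pred (R' s e (S n))).
    apply neq0_S, (run_phi _ _ Hq') in Ha, Hb; auto.
Qed.

Lemma check_good_sound C L g h :
  (forall a b c, check_good R' C L g h a b c = true) ->
  good empty (fun k => C k = true) (fun a b => L a b = true).
Proof.
  intros H; setoid_rewrite check_good_iff in H; split.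
  - now destruct (H 0 0 0).
  - intros a; now destruct (H a 0 0) as (_ & H2 & _).
  - intros a; now destruct (H a 0 0) as (_ & _ & H2 & _).
  - intros e i a HC Ha; apply (phi_run _ _ Hq') in Ha as [s Ha].
    destruct (H e s i) as (_ & _ & _ & H' & _); unfold R' in H'.
    rewrite Ha in H'; auto.
  - intros a b c; destruct (H a b c) as (_ & _ & _ & _ & H' & _); exact H'.
  - intros e F.
    destruct (proj1 (climbs_at_iff C L e (g e)) (F (g e))) as [s Hs].
    destruct (H e s 0) as (_ & _ & _ & _ & _ & H' & _); auto.
  - intros a b Hab; destruct (H a b 0) as (_ & _ & _ & _ & _ & _ & H').
    destruct (H' Hab) as [H1 H2]; exists (p1 (h a b)); split; trivial.
    destruct H2 as [H2 | [E Hr]]; auto.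
    right; do 2 eexists; split; [exact E |].
    eapply (run_phi _ _ Hq'); exact Hr.
Qed.

(** [g] picks a stage where the climb breaks down. If there is none, [good_lim] puts the limit into
    [C], and any value of [g] will do. *)
Lemma check_good_complete (C : nat -> bool) (L : nat -> nat -> bool) :
  good empty (fun k => C k = true) (fun a b => L a b = true) ->
  exists g h, forall a b c, check_good R' C L g h a b c = true.
Proof.
  intros G.
  exists (fun e => choose (fun n =>
    ~ climbs empty (fun k => C k = true) (fun a b => L a b = true) e n)).
  exists (fun a b => choose (fun z =>
    (a = p1 z \/ L a (p1 z) = true) /\
    ((b = 2 ^ p1 z /\ p1 z <> 0) \/
     (b = 3 * 5 ^ p1 (p2 z) /\
      R' (p2 (p2 (p2 z))) (p1 (p2 z)) (p1 (p2 (p2 z))) = S (p1 z))))).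
  intros a b c; apply check_good_iff; repeat apply conj.
  - apply (good_one _ _ _ G).
  - apply (good_suc _ _ _ G).
  - apply (good_lt_suc _ _ _ G).
  - intros HC Hr; apply (run_phi _ _ Hq') in Hr.
    exact (good_lt_lim _ _ _ G _ _ _ HC Hr).
  - apply (good_trans _ _ _ G).
  - intros Hs; set (P := fun n => ~ _) in Hs.
    apply NNPP; intros NC.
    assert (HP : exists n, P n).
    { apply NNPP; intros N; apply NC, (good_lim _ _ _ G).
      intros n; apply NNPP; intros Hn; eauto. }
    apply (choose_spec P HP), climbs_at_iff; eauto.
  - intros Hab; set (P := fun z => _ /\ _).
    apply (choose_spec P).
    destruct (good_lt_inv _ _ _ G _ _ Hab)
      as (x & Hx & [Hb | (e & i & Hb & Hr)]).
    + exists (pr x 0); unfold P; rewrite p1_pr; auto.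
    + apply (phi_run _ _ Hq') in Hr as [s Hr].
      exists (pr x (pr e (pr i s))); unfold P; rewrite !p2_pr, !p1_pr; auto.
Qed.

Lemma not_diag_iff n :
  ~ diag X n <->
  exists C L g h t u i w,
    (forall a b c, check_good R' C L g h a b c = true) /\
    (forall a, check_fail R R' C L t u i w n a = true).
Proof.
  split.
  - intros N.
    assert (F : exists (C : nat -> bool) (L : nat -> nat -> bool) t u i w,
      good empty (fun k => C k = true) (fun a b => L a b = true) /\
      (forall a, check_fail R R' C L t u i w n a = true)).
    2: { destruct F as (C & L & t & u & i & w & G & F).
         destruct (check_good_complete C L G) as (g & h & H).
         now exists C, L, g, h, t, u, i, w. }
    (* Sets become Boolean functions, so that they can later be stored in a function on numbers. *)
    assert (B : forall C L, good empty C L ->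
      good empty (fun k => decide (C k) = true)
                 (fun a b => decide (L a b) = true)).
    { intros C L.
      replace (fun k => decide (C k) = true) with C
        by (apply real_ext; symmetry; apply decide_iff).
      replace (fun a b => decide (L a b) = true) with L; trivial.
      apply functional_extensionality; intros a.
      apply real_ext; symmetry; apply decide_iff. }
    destruct (classic (forall k, exists v, phi X n k v)) as [T | NT].
    (* Selector [0]: the program diverges at [k]; [t] and [u] are filled with dummies. *)
    2: { apply not_all_ex_not in NT as [k Hk].
         do 2 eexists; exists id, id, 0, k; split; [apply B, good_KleeneO |].
         intros a; apply Nat.eqb_eq.
         destruct (R a n k) as [| v] eqn:E; trivial.
         destruct Hk; exists v; eapply (run_phi _ _ Hq); exact E. }
    set (t := fun k => choose (fun s => R s n k <> 0)).
    assert (Ht : forall k, R (t k) n k <> 0).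
    { intros k; apply (choose_spec (fun s => R s n k <> 0)).
      destruct (T k) as [v Hv]; apply (phi_run _ _ Hq) in Hv as [s Hs].
      exists s; unfold R; now rewrite Hs. }
    assert (Ht' : forall k, negb (R (t k) n k =? 0) = true).
    { intros k; now apply negb_true_iff, Nat.eqb_neq. }
    assert (Hv : forall k v, phi X n k v -> pred (R (t k) n k) = v).
    { intros k v Hv; apply phi_functional with X n k; trivial.
      apply (run_phi X q Hq (t k)); specialize (Ht k); unfold R in *; lia. }
    assert (HY : forall k, (p1 (pred (R (t k) n k)) =? 1) = true <->
                           exists v, phi X n k v /\ p1 v = 1).
    { intros k; rewrite Nat.eqb_eq; destruct (T k) as [v Hk]; split.
      - intros E; exists v; split; trivial; now rewrite <- (Hv _ _ Hk).
      - intros (v' & Hk' & E); now rewrite (Hv _ _ Hk'). }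
    assert (HN : forall k, ~ (exists v, phi X n k v /\ p1 v = 1) ->
                           negb (p1 (pred (R (t k) n k)) =? 1) = true).
    { intros k Hk; apply negb_true_iff, not_true_is_false; now rewrite HY. }
    destruct (classic (exists v, phi X n n v /\ p2 v = 0)) as [Z | NZ].
    2: { do 2 eexists; exists t, id, 1, 0; split; [apply B, good_KleeneO |].
         intros a; unfold check_fail; rewrite Ht'; cbn.
         apply negb_true_iff, Nat.eqb_neq; intros E.
         destruct (T n) as [v Hn]; apply NZ; exists v; split; trivial.
         now rewrite <- (Hv _ _ Hn). }
    destruct (proj1 (not_KleeneO_iff empty
      (fun k => exists v, phi X n k v /\ p1 v = 1))) as (C & L & G & H).
    { intros E; now apply N. }
    exists (fun k => decide (C k)), (fun a b => decide (L a b)), t.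
    (* Selectors [2] to [5] are the four ways of differing from O, in the order of
       [not_KleeneO_iff]. *)
    destruct H as [(k & Hk & NC) | [N1 | [(a & Ha & Na) | (e & Ne & He)]]].
    + exists id, 2, k; split; auto; intros a; unfold check_fail.
      rewrite Ht'; cbn; rewrite (proj2 (HY k)) by trivial.
      apply negb_true_iff, not_true_is_false; now rewrite decide_iff.
    + exists id, 3, 0; split; auto; intros a; unfold check_fail.
      rewrite Ht'; cbn -[pred]; auto.
    + exists id, 4, a; split; auto; intros b; unfold check_fail.
      rewrite Ht'; cbn -[Nat.pow pred].
      apply andb_true_iff; split; [now apply HY | auto].
    + set (Y := fun k => p1 (pred (R (t k) n k)) =? 1).
      exists (fun a => choose (fun s =>
        climbs_at R' Y (fun a b => decide (L a b)) s e a = true)), 5, e.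
      split; auto; intros a; unfold check_fail.
      rewrite Ht'; cbn -[Nat.pow pred Nat.mul]; rewrite HN by trivial.
      apply (choose_spec (fun s => climbs_at R' Y _ s e a = true)).
      apply climbs_at_iff; destruct (He a) as (x & y & Hx & Hy & Yx & Lxy).
      exists x, y; repeat split; trivial; [now apply HY | now apply decide_iff].
  - intros (C & L & g & h & t & u & i & w & G & F) (T & E & (v0 & Hv0 & E0)).
    apply check_good_sound in G; unfold check_fail in F.
    destruct (i =? 0).
    { destruct (T w) as [v Hv]; apply (phi_run _ _ Hq) in Hv as [s Hs].
      specialize (F s); unfold R in F; now rewrite Hs in F. }
    setoid_rewrite andb_true_iff in F.
    (* Every selector other than [0] certifies totality through the running times [t]. *)
    assert (Hr : forall k, R (t k) n k = S (pred (R (t k) n k))).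
    { intros k; destruct (F k) as [Fk _]; now apply neq0_S, negb_true_iff. }
    assert (HY : forall k, (p1 (pred (R (t k) n k)) =? 1) = true <->
                           exists v, phi X n k v /\ p1 v = 1).
    { intros k; rewrite Nat.eqb_eq; specialize (Hr k).
      apply (run_phi _ _ Hq) in Hr; split; [eauto |].
      intros (v & Hv & Ev); now rewrite (phi_functional _ _ _ _ _ Hr Hv). }
    assert (HN : forall k, negb (p1 (pred (R (t k) n k)) =? 1) = true ->
                           ~ (exists v, phi X n k v /\ p1 v = 1)).
    { intros k Hk; apply negb_true_iff in Hk; now rewrite <- HY, Hk. }
    destruct (i =? 1).
    { destruct (F 0) as [_ F']; apply negb_true_iff, Nat.eqb_neq in F'.
      specialize (Hr n); apply (run_phi _ _ Hq) in Hr.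
      now rewrite (phi_functional _ _ _ _ _ Hr Hv0) in F'. }
    apply (proj2 (not_KleeneO_iff empty
      (fun k => exists v, phi X n k v /\ p1 v = 1))); trivial.
    exists (fun k => C k = true), (fun a b => L a b = true); split; trivial.
    destruct (i =? 2); [| destruct (i =? 3); [| destruct (i =? 4)]].
    + left; exists w; destruct (F 0) as [_ F'].
      apply andb_true_iff in F' as [F1 F2]; split; [now apply HY |].
      now destruct (C w).
    + right; left; apply HN, (F 0).
    + do 2 right; left; exists w; destruct (F 0) as [_ F'].
      apply andb_true_iff in F' as [F1 F2]; split;
        [now apply HY | now apply HN].
    + do 3 right; exists w; setoid_rewrite andb_true_iff in F; split.
      * apply HN, (F 0).
      * intros a; destruct (F a) as [_ [_ Fa]].
        destruct (proj2 (climbs_at_iff _ _ _ _) (ex_intro _ _ Fa))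
          as (x & y & Hx & Hy & Yx & Lxy).
        exists x, y; repeat split; trivial; now apply HY.
Qed.

End Normal_form.

(** * Packing all witnesses into one function with local conditions *)

Section Check.
Context (X : real) (f : nat -> nat).

(** Index [0] selects [X], used to run [n]; all others select the empty oracle, over which O is
    defined. *)
Definition oracle_of (j k : nat) : nat := if j =? 0 then chi X k else 0.

Definition table (j s p : nat) : nat := f (pr 0 (pr j (pr s p))).

Definition check_table (j s p : nat) : bool :=
  (table j 0 p =? 0) &&
  (table j (S s) p =? ev_step (oracle_of j) (table j s) (p1 p) (p2 p)).

Definition table_run (j s e n : nat) : nat :=
  if p1 e <=? 8 then table j s (pr e n) else 0.

(** [f] is divided into slots by the first component of its argument: [0] the evaluator tables, [1]
    running times, [2] and [3] the sets with [0] for true, [4] and [5] the Skolem functions, [6] the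
    times for the climb, [7] the selector and its parameter. The number [m] codes a triple of test
    arguments. *)
Definition check (n m : nat) : bool :=
  check_table (p1 m) (p1 (p2 m)) (p2 (p2 m)) &&
  check_good (table_run 1)
    (fun k => f (pr 2 k) =? 0) (fun a b => f (pr 3 (pr a b)) =? 0)
    (fun e => f (pr 4 e)) (fun a b => f (pr 5 (pr a b)))
    (p1 m) (p1 (p2 m)) (p2 (p2 m)) &&
  check_fail (table_run 0) (table_run 1)
    (fun k => f (pr 2 k) =? 0) (fun a b => f (pr 3 (pr a b)) =? 0)
    (fun k => f (pr 1 k)) (fun a => f (pr 6 a)) (f (pr 7 0)) (f (pr 7 1))
    n (p1 m).

Lemma table_ev :
  (forall j s p, check_table j s p = true) ->
  forall j s e n, table j s (pr e n) = ev (oracle_of j) s e n.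
Proof.
  intros H j s; unfold check_table in H.
  induction s as [| s IH]; intros e n;
    [specialize (H j 0 (pr e n)) | specialize (H j s (pr e n))];
    apply andb_true_iff in H as [H0 H1]; apply Nat.eqb_eq in H0, H1; trivial.
  rewrite H1, p1_pr, p2_pr; apply ev_step_ext; intros p.
  now rewrite <- (pr_p p), IH, p1_pr, p2_pr.
Qed.

End Check.

Lemma not_diag_check X n :
  ~ diag X n <-> exists f, forall m, check X f n m = true.
Proof.
  assert (Q0 : forall k, oracle_of X 0 k = chi X k) by easy.
  assert (Q1 : forall k, oracle_of X 1 k = chi empty k).
  { intros k; symmetry; now apply chi_out. }
  rewrite (not_diag_iff X _ _ Q0 Q1); split.
  - intros (C & L & g & h & t & u & i & w & G & F).
    set (f := fun x =>
      let y := p2 x in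
      match p1 x with
      | 0 => ev (oracle_of X (p1 y)) (p1 (p2 y))
               (p1 (p2 (p2 y))) (p2 (p2 (p2 y)))
      | 1 => t y
      | 2 => Nat.b2n (negb (C y))
      | 3 => Nat.b2n (negb (L (p1 y) (p2 y)))
      | 4 => g y
      | 5 => h (p1 y) (p2 y)
      | 6 => u y
      | _ => if y =? 0 then i else w
      end).
    assert (Ht : table f = fun j s p => ev (oracle_of X j) s (p1 p) (p2 p)).
    { do 3 (apply functional_extensionality; intro).
      unfold table, f; now rewrite !p2_pr, !p1_pr. }
    assert (HR : forall j, table_run f j = run (oracle_of X j)).
    { intros j; do 3 (apply functional_extensionality; intro).
      unfold table_run, run; now rewrite Ht, p1_pr, p2_pr. }
    assert (HC : (fun k => f (pr 2 k) =? 0) = C).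
    { apply functional_extensionality; intros k.
      unfold f; rewrite p1_pr, p2_pr; now destruct (C k). }
    assert (HL : (fun a b => f (pr 3 (pr a b)) =? 0) = L).
    { do 2 (apply functional_extensionality; intro).
      unfold f; rewrite p1_pr, !p2_pr, p1_pr; now destruct (L _ _). }
    assert (E : forall k y, f (pr k y) = match k with
      | 1 => t y | 4 => g y | 5 => h (p1 y) (p2 y) | 6 => u y
      | 7 => if y =? 0 then i else w | _ => f (pr k y) end).
    { intros k y; unfold f; rewrite p1_pr, p2_pr.
      now do 8 (destruct k as [| k]; [easy |]). }
    assert (Hg : (fun e => f (pr 4 e)) = g).
    { apply functional_extensionality; intro; apply E. }
    assert (Hh : (fun a b => f (pr 5 (pr a b))) = h).
    { do 2 (apply functional_extensionality; intro).
      now rewrite E, p1_pr, p2_pr. }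
    assert (Htt : (fun k => f (pr 1 k)) = t).
    { apply functional_extensionality; intro; apply E. }
    assert (Hu : (fun k => f (pr 6 k)) = u).
    { apply functional_extensionality; intro; apply E. }
    exists f; intros m; unfold check.
    rewrite !HR, HC, HL, Hg, Hh, Htt, Hu, !(E 7).
    apply andb_true_iff; split; [| apply F].
    apply andb_true_iff; split; [| apply G].
    unfold check_table; rewrite Ht; apply andb_true_iff; split.
    + apply Nat.eqb_refl.
    + apply Nat.eqb_refl.
  - intros [f H]; unfold check in H.
    assert (H1 := fun a b c => H (pr a (pr b c))); cbv beta in H1; clear H.
    repeat setoid_rewrite p2_pr in H1; repeat setoid_rewrite p1_pr in H1.
    do 2 setoid_rewrite andb_true_iff in H1.
    assert (HR : forall j, table_run f j = run (oracle_of X j)).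
    { intros j; do 3 (apply functional_extensionality; intro).
      unfold table_run, run; rewrite (table_ev X); trivial; apply H1. }
    rewrite !HR in H1; do 8 eexists; split;
      [intros a b c; apply (H1 a b c) | intros a; apply (H1 a 0 0)].
Qed.

(** * Computability of the check and the index of the diagonal set *)

Definition orc (i : real * (nat -> nat)) : real := join (fst i) (graph (snd i)).

Lemma cp_arg F : cp orc F -> cp orc (fun i n => chi (fst i) (F i n)).
Proof.
  intros H; apply cp_ext with (fun i n => chi (orc i) (2 * F i n)).
  - intros i n; apply chi_iff, join_even.
  - auto 10 with cp.
Qed.

(** A value of the function is recovered from its graph by unbounded search, which halts as the
    function is total. *)
Lemma cp_app F : cp orc F -> cp orc (fun i n => snd i (F i n)).
Proof.
  intros H; apply (cp_comp _ (fun i => snd i)); trivial.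
  assert (E : forall i n k,
    chi (orc i) (S (2 * pr n k)) = 1 <-> k = snd i n).
  { intros i n k; rewrite (chi_iff _ (graph (snd i)) _ (pr n k))
      by apply join_odd.
    split.
    - intros Hk; apply chi_true in Hk as [x Hx].
      now apply pr_inj in Hx as [-> ->].
    - intros ->; apply chi_in; now exists n. }
  apply cp_mu with (fun i p => 1 - chi (orc i) (S (2 * p))).
  - auto 10 with cp.
  - intros i n; now rewrite (proj2 (E i n (snd i n))).
  - intros i n k L; specialize (E i n k).
    assert (chi (orc i) (S (2 * pr n k)) <> 1) as N by (rewrite E; lia).
    unfold chi in *; now destruct excluded_middle_informative.
Qed.

#[local] Hint Resolve cp_arg cp_app : cp.

Lemma cp_check :
  cpb orc (fun i p => check (fst i) (snd i) (p1 p) (p2 p)).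
Proof.
  unfold check, check_table, check_good, check_fail, climbs_at, table_run,
    table, ev_step, oracle_of, table.
  auto 200 with cp.
Qed.

(** The index is that of a search for a failing check: it halts on every [f] exactly when no [f]
    witnesses [~ diag X n]. *)
Lemma diag_V : exists e, forall X n, V e X n <-> diag X n.
Proof.
  destruct cp_check as [c Hc]; exists (encode (Mu c)); intros X n.
  assert (HV : V (encode (Mu c)) X n <->
               forall f, exists m, check X f n m = false).
  { assert (Ev : forall f m, eval (join X (graph f)) c (pr n m)
                               (Nat.b2n (check X f n m))).
    { intros f m; specialize (Hc (X, f) (pr n m)).
      cbv beta in Hc; rewrite p1_pr, p2_pr in Hc; exact Hc. }
    unfold V; split; intros H f; specialize (H f).
    - destruct H as (m & d & E & H); apply encode_inj in E as ->.
      inversion H; subst; exists m.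
      match goal with A : eval _ c _ 0 |- _ =>
        pose proof (eval_functional _ _ _ _ _ A (Ev f m)) as E end.
      now destruct (check X f n m).
    - apply dec_inh_nat_subset_has_unique_least_element in H;
        [| intros m; destruct (check X f n m); [now right | now left]].
      destruct H as (m & [Hm Lm] & _); exists m, (Mu c); split; trivial.
      constructor.
      + intros i Hi; exists 0; specialize (Ev f i).
        destruct (check X f n i) eqn:E; [trivial |].
        specialize (Lm i E); lia.
      + specialize (Ev f m); now rewrite Hm in Ev. }
  rewrite HV; split.
  - intros H; apply NNPP; intros N; apply not_diag_check in N as [f Hf].
    destruct (H f) as [m Hm]; specialize (Hf m); congruence.
  - intros D f; apply NNPP; intros N; revert D; apply not_diag_check.
    exists f; intros m; destruct (check X f n m) eqn:E; trivial.
    destruct N; eauto.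
Qed.

(** * Reals that are not hyperarithmetical *)

Lemma Hset_nonzero X Y : ~ Hset X 0 Y.
Proof.
  intros H; inversion H as [| a Z _ E | e s Z _ _ E].
  - now apply (Nat.pow_nonzero 2 a).
  - pose proof (lim_index_ge e); lia.
Qed.

(** Since [2 ^ 0 = 1], the successor rule could compete with the base rule at [1]; it does not, as
    [0] carries no set. *)
Lemma Hset_pow2 X a Y : Hset X a Y -> 1 <> 2 ^ a.
Proof.
  destruct a as [| a]; [now intros H%Hset_nonzero |].
  intros _ E; pose proof (Nat.pow_gt_1 2 (S a)); lia.
Qed.

Lemma Hset_functional X a Y Y' : Hset X a Y -> Hset X a Y' -> Y = Y'.
Proof.
  intros H; revert Y'.
  induction H as [| a Y H IH | e s Y Hs H IH]; intros Y' H';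
    inversion H' as [E | b Z HZ E | d s' Z Hs' HZ E].
  - trivial.
  - now destruct (Hset_pow2 _ _ _ HZ).
  - pose proof (lim_index_ge d); lia.
  - now destruct (Hset_pow2 _ _ _ H).
  - apply pow2_inj in E as ->; f_equal; auto.
  - symmetry in E; now apply pow2_lim_index in E.
  - pose proof (lim_index_ge e); lia.
  - now apply pow2_lim_index in E.
  - apply lim_index_inj in E as ->.
    assert (EY : Y = Z); [| now rewrite EY].
    { apply functional_extensionality; intros n; apply IH.
      now rewrite (phi_functional _ _ _ _ _ (Hs n) (Hs' n)). }
Qed.

Lemma non_HYP : exists Z, lt_HYP empty Z.
Proof.
  (* The pair of [a] and [c] is put in when [c], run on that very pair over the set of level [a],
     does not return [1]; no single [c] and level can then decide membership. *)
  exists (fun n => exists a c H, n = pr a (encode c) /\ Hset empty a H /\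
                                 ~ eval H c n 1); split.
  - exists 1, (fun n => exists a c H, n = pr a (encode c) /\ Hset empty a H /\
                                 ~ eval H c n 1).
    repeat split; [constructor | constructor | apply empty_le_T].
  - intros (a & H & _ & HH & c & Hc); specialize (Hc (pr a (encode c))).
    set (Z := exists a' c' H', _) in Hc; destruct Hc as [H1 H0].
    assert (N : ~ Z).
    { intros HZ; pose proof (H1 HZ) as Ev.
      destruct HZ as (a' & c' & H' & E & HH' & N).
      apply pr_inj in E as [<- E]; apply encode_inj in E as <-.
      now rewrite (Hset_functional _ _ _ _ HH' HH) in N. }
    apply N; exists a, c, H; repeat split; trivial.
    intros Ev; pose proof (eval_functional _ _ _ _ _ Ev (H0 N)); easy.
Qed.

Lemma pow2_pow3_inj k l m n : 2 ^ k * 3 ^ m = 2 ^ l * 3 ^ n -> m = n.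
Proof.
  assert (O : forall i j m, 2 ^ S i * 3 ^ m <> 2 ^ 0 * 3 ^ j).
  { intros i j p E; apply (f_equal Nat.odd) in E.
    now rewrite Nat.pow_succ_r', !Nat.odd_mul, !(odd_pow 3) in E. }
  revert l; induction k as [| k IH]; intros [| l] E.
  - rewrite !Nat.mul_1_l in E; apply Nat.pow_inj_r in E; lia.
  - now symmetry in E; apply O in E.
  - now apply O in E.
  - apply (IH l); rewrite !Nat.pow_succ_r', <- !Nat.mul_assoc in E; lia.
Qed.

(** Spreads one non-hyperarithmetical real over all columns, which meets the hypothesis on every
    column at once. *)
Lemma column_constant Z : exists W, forall k, column W k = Z.
Proof.
  exists (fun m => exists k n, m = 2 ^ k * 3 ^ n /\ Z n); intros k.
  apply real_ext; intros n; split; [| unfold column; eauto].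
  intros (l & p & E & H); apply pow2_pow3_inj in E as ->; trivial.
Qed.

(** * The operator without inversion *)

Lemma diag_O_computable X n : diag X n -> le_T (KleeneO empty) X.
Proof.
  (* Halting at the single argument [0] already shows that [n] codes a program [c]. *)
  intros (T & Y & _); destruct (T 0) as (_ & c & <- & _); apply le_T_cp.
  set (F := fun k => choose (fun v => eval X c k v)).
  assert (HF : forall k, eval X c k (F k)).
  { intros k; apply choose_spec.
    destruct (T k) as (v & d & E & H); apply encode_inj in E as ->; eauto. }
  apply cp_ext with (fun _ k => Nat.b2n (p1 (F k) =? 1)).
  - intros _ k; destruct (Nat.eqb_spec (p1 (F k)) 1) as [E | N].
    + symmetry; apply chi_in, Y; exists (F k); split; trivial; now exists c.
    + symmetry; apply chi_out; rewrite <- Y.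
      intros (v & (d & E & H) & Hv); apply encode_inj in E as ->.
      now rewrite (eval_functional _ _ _ _ _ (HF k) H) in N.
  - apply cpb_eqb; [| auto with cp].
    apply cp_p1; exists c; auto.
Qed.

(** Pairing programs for O and for [diag X] gives a program [c] satisfying the first two clauses of
    [diag]; the third says that [c] is in [diag X] iff its own computation says it is not. *)
Lemma diag_not_le_T X : le_T (KleeneO empty) X -> ~ le_T (diag X) X.
Proof.
  rewrite !le_T_cp; intros HO HD.
  destruct (cp_pr _ _ _ HO HD) as [c Hc].
  specialize (Hc tt); cbv beta in Hc.
  assert (P : forall k v, phi X (encode c) k v ->
                          v = pr (chi (KleeneO empty) k) (chi (diag X) k)).
  { intros k v (d & E & H); apply encode_inj in E as ->.
    eapply eval_functional; eauto. }
  assert (D : diag X (encode c) <-> chi (diag X) (encode c) = 0).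
  { split.
    - intros (_ & _ & v & Hv & E); apply P in Hv as ->; now rewrite p2_pr in E.
    - intros E; split; [| split].
      + intros k; eexists; exists c; eauto.
      + intros k; split.
        * intros (v & Hv & E1); apply P in Hv as ->; rewrite p1_pr in E1.
          now apply chi_true in E1.
        * intros H; eexists; split; [exists c; eauto |].
          rewrite p1_pr; now apply chi_in.
      + eexists; split; [exists c; eauto |]; now rewrite p2_pr. }
  unfold chi in D; destruct excluded_middle_informative; intuition discriminate.
Qed.

Lemma HJ_not_join_O :
  exists e, forall B, ~ eq_T (HJ e B) (join B (KleeneO empty)).
Proof.
  destruct diag_V as [e He]; exists e; intros B [H1 H2].
  unfold HJ in H1, H2.
  replace (V e B) with (diag B) in H1, H2
    by (apply real_ext; intros n; symmetry; apply He).
  assert (HO : le_T (KleeneO empty) B).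
  (* Otherwise [diag B] is empty, and the join with it computes no more than [B]. *)
  { apply NNPP; intros N; apply N.
    apply le_T_trans with (join B (KleeneO empty)); [apply le_T_join_r |].
    apply le_T_trans with (join B (diag B)); trivial.
    apply join_le_T; [apply le_T_refl |].
    replace (diag B) with empty; [apply empty_le_T |].
    apply real_ext; intros n; split; [easy |].
    intros D; now apply diag_O_computable in D. }
  apply (diag_not_le_T B HO).
  apply le_T_trans with (join B (diag B)); [apply le_T_join_r |].
  apply le_T_trans with (join B (KleeneO empty)); trivial.
  apply join_le_T; [apply le_T_refl | trivial].
Qed.

Theorem corollary3p1 (K : real -> Prop) :
  ~ (forall (e : nat) (A : real),
       le_T (KleeneO empty) A ->
       exists B, K B /\
         eq_T A (HJ e B) /\ eq_T (HJ e B) (join B (KleeneO empty)))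
  /\
  ~ (forall (e : nat) (Z A : real),
       le_T (join Z (KleeneO empty)) A ->
       (forall k, lt_HYP empty (column Z k)) ->
       exists B, K B /\
         eq_T A (HJ e B) /\ eq_T (HJ e B) (join B (KleeneO empty)) /\
         (forall k, ~ le_HYP (column Z k) B))
  /\
  ~ (forall (e : nat) (Z A : real),
       le_T (join Z (KleeneO empty)) A ->
       lt_HYP empty Z ->
       exists B, K B /\
         eq_T A (HJ e B) /\ eq_T (HJ e B) (join B Z) /\
         eq_T (join B Z) (join B (KleeneO empty))).
Proof.
  destruct HJ_not_join_O as [e He], non_HYP as [Z HZ].
  split; [| split]; intros H.
  (* [A] is taken to be its own lower bound; the contradiction lies in the equivalence between
     [HJ e B] and the join with O. *)
  - destruct (H e _ (le_T_refl _)) as (B & _ & _ & HB); exact (He B HB).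
  - destruct (column_constant Z) as [W HW].
    destruct (H e W _ (le_T_refl _)) as (B & _ & _ & HB & _);
      [intros k; now rewrite HW | exact (He B HB)].
  (* Here that equivalence is composed from two, through the join of [B] and [Z]. *)
  - destruct (H e Z _ (le_T_refl _) HZ) as (B & _ & _ & [H1 H2] & [H3 H4]).
    apply (He B); split; eapply le_T_trans; eauto.
Qed.
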